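(* Let $(E,\star,\rho,(\cdot,\cdot)_-,P)$ be a para-complex pre-symplectic algebroid, with bracket $[e_1,e_2]_E=e_1\star e_2-e_2\star e_1$. Define $g(e_1,e_2)=(e_1,P(e_2))_-$ for $e_1,e_2\in\Gamma(E)$. Then $(E,[\cdot,\cdot]_E,\rho,g)$ is a pseudo-Riemannian Lie algebroid. Furthermore, for all $x,y\in\Gamma(E^+)$ and $\xi,\eta\in\Gamma(E^-)$, $$\nabla^g_xy=x\star y,\qquad\nabla^g_\xi\eta=\xi\star\eta,$$ where $\nabla^g$ is the Levi-Civita $E$-connection of $g$, and $E^{+}$, $E^{-}$ are the $+1$ and $-1$ eigenbundles of $P$.
   Context: All vector bundles are real, of finite rank, over a fixed smooth manifold $M$; bundle maps cover the identity of $M$. A Lie algebroid $(E,[\cdot,\cdot]_E,\rho)$ is a vector bundle $E\to M$ with a Lie algebra structure on $\Gamma(E)$ and a bundle map $\rho:E\to TM$ with $[e_1,fe_2]_E=f[e_1,e_2]_E+\rho(e_1)(f)e_2$. A pseudo-Riemannian Lie algebroid is a Lie algebroid with a pseudo-Riemannian metric $g$, i.e. a nondegenerate symmetric bilinear form on $E$. Its Levi-Civita $E$-connection $\nabla^g$ is the unique $E$-connection on $E$ with $\rho(e_1)g(e_2,e_3)=g(\nabla^g_{e_1}e_2,e_3)+g(e_2,\nabla^g_{e_1}e_3)$ and $[e_1,e_2]_E=\nabla^g_{e_1}e_2-\nabla^g_{e_2}e_1$; it is given by $$2g(\nabla^g_{e_1}e_2,e_3)=\rho(e_1)g(e_2,e_3)+\rho(e_2)g(e_1,e_3)-\rho(e_3)g(e_1,e_2)+g([e_3,e_1]_E,e_2)+g([e_3,e_2]_E,e_1)+g([e_1,e_2]_E,e_3).$$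 A pre-symplectic algebroid $(E,\star,\rho,(\cdot,\cdot)_-)$ is a vector bundle $E\to M$ equipped with a nondegenerate skew-symmetric ($C^\infty(M)$-)bilinear form $(\cdot,\cdot)_-$, an ($\mathbb R$-bilinear) multiplication $\star:\Gamma(E)\times\Gamma(E)\to\Gamma(E)$ and a bundle map $\rho:E\to TM$ such that for all $e_1,e_2,e_3\in\Gamma(E)$: (i) $(e_1,e_2,e_3)-(e_2,e_1,e_3)=\frac16 D\,T(e_1,e_2,e_3)$; (ii) $\rho(e_1)(e_2,e_3)_-=(e_1\star e_2-\frac12D(e_1,e_2)_-,\,e_3)_-+(e_2,[e_1,e_3]_E)_-$. Here $(e_1,e_2,e_3)=e_1\star(e_2\star e_3)-(e_1\star e_2)\star e_3$; $T(e_1,e_2,e_3)=(e_1\star e_2,e_3)_-+(e_1,e_2\star e_3)_--(e_2\star e_1,e_3)_--(e_2,e_1\star e_3)_-\in C^\infty(M)$; $D:C^\infty(M)\to\Gamma(E)$ is defined by $(Df,e)_-=\rho(e)(f)$; and $[e_1,e_2]_E=e_1\star e_2-e_2\star e_1$. A para-complex pre-symplectic algebroid $(E,\star,\rho,(\cdot,\cdot)_-,P)$ is a pre-symplectic algebroid with a bundle map $P:E\to E$ such that $P^2=\mathrm{id}$, $(P(x),P(y))_-=-(x,y)_-$, and $P(e_1\star e_2)=P(e_1)\star e_2+e_1\star P(e_2)-P(P(e_1)\star P(e_2))$ for all sections. *)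

(* Defs.v *)
From HB Require Import structures.
From mathcomp Require Import all_boot all_order all_algebra.
From mathcomp Require Import all_classical all_reals interval_inference topology normedtype landau derive.

Set Implicit Arguments.
Unset Strict Implicit.
Unset Printing Implicit Defensive.
Import Order.TTheory GRing.Theory Num.Theory numFieldNormedType.Exports.
Local Open Scope classical_set_scope.
Local Open Scope ring_scope.

(* f is of class C^k on U (meaningful for open U): k-fold Frechet
   differentiability, phrased through the directional derivatives of f, with
   continuity at the last stage. *)
Fixpoint Ck (R : realType) (n : nat) (k : nat) (U : set 'rV[R]_n)
    (f : 'rV[R]_n -> R) : Prop :=
  if k is k'.+1 then
    (forall p, U p -> differentiable f p) /\ (forall v, Ck k' U ('D_v f))
  else forall p, U p -> {for p, continuous f}.

Definition smooth_on (R : realType) (n : nat) (U : set 'rV[R]_n)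
  (f : 'rV[R]_n -> R) : Prop := forall k, Ck k U f.

Section Ck_theory.
Context {R : realType} {n : nat}.
Implicit Types (U V : set 'rV[R]_n) (f g : 'rV[R]_n -> R).

Lemma Ck_sub k U V f : U `<=` V -> Ck k V f -> Ck k U f.
Proof.
move=> UV; elim: k f => [|k IH] f /= => [H p /UV/H//|[H1 H2]].
by split=> [p /UV/H1//|v]; apply: IH.
Qed.

Lemma Ck_local k U f : (forall p, U p -> Ck k [set p] f) -> Ck k U f.
Proof.
elim: k f => [|k IH] f /= H; first by move=> p Up; exact: (H p Up p erefl).
split=> [p Up|v]; first by have [H1 _] := H p Up; exact: H1 p erefl.
by apply: IH => p Up; have [_] := H p Up.
Qed.

Lemma Ck_cont k U f p : Ck k U f -> U p -> {for p, continuous f}.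
Proof.
case: k => [|k] /=; first by move=> H /H.
by move=> [H _] /H /differentiable_continuous.
Qed.

Lemma CkW k U f : Ck k.+1 U f -> Ck k U f.
Proof.
elim: k f => [|k IH] f => [[H _] p /H|[H1 H2]].
  exact: differentiable_continuous.
by split=> // v; apply/IH/H2.
Qed.

Lemma near_eq_differentiable f g (p : 'rV[R]_n) :
  (\near p, f p = g p) -> differentiable f p -> differentiable g p.
Proof.
move=> fg df; pose h := g - f.
have hE : h \o shift p = cst (h p) + (0 : 'rV[R]_n -> R) +o_ (0 : 'rV[R]_n) id.
  apply/eqaddoP => _/posnumP[e].
  have h0 : \near p, h p = 0 by apply: filterS fg => q e'; rewrite /h !fctE e' subrr.
  have : \forall y \near (0 : 'rV[R]_n), h (y + p) = 0.
    have := h0; rewrite -{1}[p]add0r.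
    by rewrite (near_shift (0 : 'rV[R]_n)) /= subr0 add0r.
  apply: filterS => y hy.
  rewrite !fctE /= hy (nbhs_singleton h0) !(addr0, subr0) normr0.
  by rewrite mulr_ge0.
have dh : differentiable h p.
  have c0 : continuous (\0 : 'rV[R]_n -> R) by move=> x; exact: cst_continuous.
  have d0 := @diff_unique _ _ _ h (\0 : {linear 'rV[R]_n -> R}) p c0 hE.
  apply/diff_locallyP; split; rewrite d0 //.
by rewrite -[g](subrK f) -/h; apply: differentiableD.
Unshelve. all: by end_near. Qed.

Lemma Ck_eq k U f g : open U -> {in U, f =1 g} -> Ck k U f -> Ck k U g.
Proof.
move=> oU; elim: k f g => [|k IH] f g fg /=.
  move=> H p Up; have := H _ Up; rewrite /prop_for /continuous_at => cf.
  have e : \near p, f p = g p.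
    by apply: filterS (open_nbhs_nbhs (conj oU Up)) => q /mem_set/fg.
  rewrite -(nbhs_singleton e); apply: cvg_trans cf; exact: (@near_eq_cvg _ _ (nbhs p)).
move=> [H1 H2]; have e p : U p -> \near p, f p = g p.
  by move=> Up; apply: filterS (open_nbhs_nbhs (conj oU Up)) => q /mem_set/fg.
split=> [p Up|v].
  exact: near_eq_differentiable (e _ Up) (H1 _ Up).
by apply: (IH ('D_v f)) => // p /set_mem/e/near_eq_derive.
Qed.

Lemma Ck_cst k U (c : R) : Ck k U (fun=> c).
Proof.
have cE (d : R) : (fun=> d) = cst d :> ('rV[R]_n -> R) by [].
elim: k c => [|k IH] c /= => [p _|]; first exact: cst_continuous.
split=> [p _|v]; first by rewrite cE; exact: differentiable_cst.
rewrite (_ : 'D_v _ = fun=> 0) //.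
by apply/funext => p; rewrite cE derive_cst.
Qed.

Lemma CkD k U f g : open U -> Ck k U f -> Ck k U g -> Ck k U (f \+ g).
Proof.
move=> oU; elim: k f g => [|k IH] f g /=.
  by move=> Hf Hg p Up; apply: continuousD; [exact: Hf|exact: Hg].
move=> [f1 f2] [g1 g2]; split=> [p Up|v].
  exact: (differentiableD (f1 _ Up) (g1 _ Up)).
apply: (Ck_eq oU _ (IH _ _ (f2 v) (g2 v))) => p /set_mem Up /=.
by rewrite -deriveD //; apply: diff_derivable; [exact: f1|exact: g1].
Qed.

Lemma CkM k U f g : open U -> Ck k U f -> Ck k U g -> Ck k U (f \* g).
Proof.
move=> oU; elim: k f g => [|k IH] f g.
  by move=> Hf Hg p Up; apply: continuousM; [exact: Hf|exact: Hg].
move=> Hf Hg; have [f1 f2] := Hf; have [g1 g2] := Hg; split=> [p Up|v].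
  exact: (differentiableM (f1 _ Up) (g1 _ Up)).
have := CkD oU (IH _ _ (CkW Hf) (g2 v)) (IH _ _ (CkW Hg) (f2 v)).
apply: (Ck_eq oU) => p /set_mem Up /=.
by rewrite deriveM //; apply: diff_derivable; [exact: f1|exact: g1].
Qed.

End Ck_theory.

Section manifold.
Context {R : realType} {n : nat}.

(* A homeomorphism between an open subset [cdom] of M and an open subset of R^n.
   [cmap] and [cinv] are total; only their values on [cdom] and on the image of
   [cdom] matter. *)
Record chart (M : topologicalType) := Chart {
  cdom : set M;
  cmap : M -> 'rV[R]_n;
  cinv : 'rV[R]_n -> M;
  cdom_open : open cdom;
  cimg_open : open (cmap @` cdom);
  cmapK : forall x, cdom x -> cinv (cmap x) = x;
  cmap_continuous : {within cdom, continuous cmap};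
  cinv_continuous : {within cmap @` cdom, continuous cinv} }.

(* Any smooth atlas will do (it need not be maximal): it determines the smooth
   structure, hence the smooth functions below. *)
Record manifold := Manifold {
  mcarrier :> topologicalType;
  atlas : set (chart mcarrier);
  manifold_hausdorff : hausdorff_space mcarrier;
  manifold_second_countable : @second_countable mcarrier;
  atlas_cover : forall x, exists2 c, atlas c & cdom c x;
  atlas_compat : forall c d, atlas c -> atlas d -> forall j,
    smooth_on (cmap c @` (cdom c `&` cdom d))
              (fun p => cmap d (cinv c p) 0 j) }.

Definition smooth_in (M : manifold) (U : set M) (f : M -> R) : Prop :=
  forall c, atlas c -> smooth_on (cmap c @` (cdom c `&` U)) (f \o cinv c).

End manifold.
Arguments chart R n M : clear implicits.
Arguments manifold R n : clear implicits.

Section smooth_in_theory.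
Context {R : realType} {n : nat} {M : manifold R n}.
Implicit Types (U V : set M) (f g : M -> R).

Lemma cimg_sub_open (c : chart R n M) U :
  open U -> open (cmap c @` (cdom c `&` U)).
Proof.
move=> oU; pose I := cmap c @` cdom c.
have -> : cmap c @` (cdom c `&` U) = I `&` cinv c @^-1` U.
  apply/seteqP; split=> p /=.
    by case=> x [cx Ux] <-; split; [exists x|rewrite /= cmapK].
  by case=> -[x cx <-] /=; rewrite cmapK // => Ux; exists x.
have := @cinv_continuous R n M c; rewrite continuousP => /(_ U oU).
move=> oc; have [V oV VE] := (open_subspaceP _ _).1 oc; rewrite -/I in VE.
by rewrite setIC -VE; apply: openI => //; exact: cimg_open.
Qed.

Lemma smooth_in_sub U V f : U `<=` V -> smooth_in V f -> smooth_in U f.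
Proof.
move=> UV H c ac k; apply: Ck_sub (H c ac k).
by move=> _ [x [cx Ux] <-]; exists x => //; split=> //; exact: UV.
Qed.

Lemma smooth_in_local U f :
  (forall x, U x -> exists2 V, V x & smooth_in V f) -> smooth_in U f.
Proof.
move=> H c ac k; apply: Ck_local => _ [x [cx Ux] <-].
have [V Vx fV] := H _ Ux; apply: Ck_sub (fV c ac k) => _ ->.
by exists x.
Qed.

Lemma smooth_in_eq U f g : open U -> (forall x, U x -> f x = g x) ->
  smooth_in U f -> smooth_in U g.
Proof.
move=> oU fg H c ac k; move: (H c ac k); apply: Ck_eq.
  exact: cimg_sub_open.
by move=> _ /set_mem[x [cx Ux] <-] /=; rewrite cmapK // fg.
Qed.

Lemma smooth_in_cst U (a : R) : smooth_in U (fun=> a).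
Proof. by move=> c ac k; exact: Ck_cst. Qed.

Lemma smooth_inD U f g : open U ->
  smooth_in U f -> smooth_in U g -> smooth_in U (fun x => f x + g x).
Proof.
move=> oU F G c ac k; move: (F c ac k) (G c ac k).
by apply: (@CkD R n k); exact: cimg_sub_open.
Qed.

Lemma smooth_inM U f g : open U ->
  smooth_in U f -> smooth_in U g -> smooth_in U (fun x => f x * g x).
Proof.
move=> oU F G c ac k; move: (F c ac k) (G c ac k).
by apply: (@CkM R n k); exact: cimg_sub_open.
Qed.

Lemma smooth_inN U f : open U ->
  smooth_in U f -> smooth_in U (fun x => - f x).
Proof.
move=> oU F; apply: (smooth_in_eq oU _ (smooth_inM oU (smooth_in_cst _ (-1)) F)).
by move=> x _ /=; rewrite mulN1r.
Qed.

Lemma smooth_in_sum (I : Type) (s : seq I) U (F : I -> M -> R) : open U ->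
  (forall i, smooth_in U (F i)) -> smooth_in U (fun x => \sum_(i <- s) F i x).
Proof.
move=> oU H; elim: s => [|i s IH].
  apply: (smooth_in_eq oU _ (smooth_in_cst _ 0)) => x _ /=.
  by rewrite big_nil.
apply: (smooth_in_eq oU _ (smooth_inD oU (H i) IH)) => x _ /=.
by rewrite big_cons.
Qed.

End smooth_in_theory.

Section Cinf.
Context {R : realType} {n : nat} (M : manifold R n).

Record Cinf := MkCinf { Cinf_fun :> M -> R; CinfP : smooth_in setT Cinf_fun }.

Lemma Cinf_eq (f g : Cinf) : f =1 g -> f = g.
Proof.
case: f g => [f fP] [g gP] /= /funext E; case: _ / E gP => gP.
by congr MkCinf; exact: Prop_irrelevance.
Qed.

HB.instance Definition _ := gen_eqMixin Cinf.
HB.instance Definition _ := gen_choiceMixin Cinf.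

Definition Ccst (c : R) : Cinf := MkCinf (smooth_in_cst setT c).
Definition Cadd (f g : Cinf) : Cinf :=
  MkCinf (smooth_inD openT (CinfP f) (CinfP g)).
Definition Copp (f : Cinf) : Cinf := MkCinf (smooth_inN openT (CinfP f)).
Definition Cmul (f g : Cinf) : Cinf :=
  MkCinf (smooth_inM openT (CinfP f) (CinfP g)).

Fact CaddA : associative Cadd.
Proof. by move=> f g h; apply: Cinf_eq => x /=; rewrite addrA. Qed.
Fact CaddC : commutative Cadd.
Proof. by move=> f g; apply: Cinf_eq => x /=; rewrite addrC. Qed.
Fact Cadd0 : left_id (Ccst 0) Cadd.
Proof. by move=> f; apply: Cinf_eq => x /=; rewrite add0r. Qed.
Fact CaddN : left_inverse (Ccst 0) Copp Cadd.
Proof. by move=> f; apply: Cinf_eq => x /=; rewrite addNr. Qed.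
HB.instance Definition _ := GRing.isZmodule.Build Cinf CaddA CaddC Cadd0 CaddN.

Fact CmulA : associative Cmul.
Proof. by move=> f g h; apply: Cinf_eq => x /=; rewrite mulrA. Qed.
Fact CmulC : commutative Cmul.
Proof. by move=> f g; apply: Cinf_eq => x /=; rewrite mulrC. Qed.
Fact Cmul1 : left_id (Ccst 1) Cmul.
Proof. by move=> f; apply: Cinf_eq => x /=; rewrite mul1r. Qed.
Fact CmulD : left_distributive Cmul Cadd.
Proof. by move=> f g h; apply: Cinf_eq => x /=; rewrite mulrDl. Qed.
HB.instance Definition _ :=
  GRing.Zmodule_isComPzRing.Build Cinf CmulA CmulC Cmul1 CmulD.

(* The tangent space T_x M: derivations at x of the algebra of smooth functions,
   with the pointwise linear structure. *)
Record tangent (x : M) := Tangent {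
  tangent_fun :> Cinf -> R;
  tangentD : forall f g, tangent_fun (f + g) = tangent_fun f + tangent_fun g;
  tangentZ : forall c f, tangent_fun (Ccst c * f) = c * tangent_fun f;
  tangentM : forall f g, tangent_fun (f * g) =
    f x * tangent_fun g + g x * tangent_fun f }.

End Cinf.

Section vbundle.
Context {R : realType} {n : nat} {M : manifold R n}.

(* A local trivialization of the family of vector spaces E over the open set
   [tdom]; the values of [tmap] and [tinv] outside [tdom] are irrelevant. *)
Record local_triv (r : nat) (E : M -> lmodType R) := LocalTriv {
  tdom : set M;
  tmap : forall x, E x -> 'rV[R]_r;
  tinv : forall x, 'rV[R]_r -> E x;
  tdom_open : open tdom;
  tmap_linear : forall x, tdom x -> linear (@tmap x);
  tmapK : forall x, tdom x -> cancel (@tmap x) (@tinv x);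
  tinvK : forall x, tdom x -> cancel (@tinv x) (@tmap x) }.

(* A smooth real vector bundle of rank r, given by its fibers and a covering
   family of local trivializations with smooth transition functions; the
   topology and the smooth structure of the total space are the ones for which
   the trivializations are diffeomorphisms. *)
Record vbundle (r : nat) := VBundle {
  fiber :> M -> lmodType R;
  trivs : set (local_triv r fiber);
  trivs_cover : forall x, exists2 t, trivs t & tdom t x;
  trivs_compat : forall s t, trivs s -> trivs t -> forall v j,
    smooth_in (tdom s `&` tdom t) (fun x => tmap t (tinv s x v) 0 j) }.

Lemma tinv_linear r E (t : @local_triv r E) x : tdom t x -> linear (tinv t x).
Proof.
move=> tx a u v; apply: (can_inj (tmapK tx)).
by rewrite tmap_linear // !tinvK.
Qed.

Lemma smooth_contract r (E : vbundle r) (t : local_triv r E)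
    (s : forall x, E x) (L : forall x, E x -> R) :
  (forall j, smooth_in (tdom t) (fun x => tmap t (s x) 0 j)) ->
  (forall x, tdom t x -> scalar (L x)) ->
  (forall v, smooth_in (tdom t) (fun x => L x (tinv t x v))) ->
  smooth_in (tdom t) (fun x => L x (s x)).
Proof.
move=> sP Llin LP; have oT := tdom_open t.
pose F j x := tmap t (s x) 0 j * L x (tinv t x (delta_mx 0 j)).
have FP j : smooth_in (tdom t) (F j) by exact: smooth_inM.
apply: (smooth_in_eq oT _ (smooth_in_sum (index_enum 'I_r) oT FP)) => x tx.
pose T := GRing.isLinear.Build _ _ _ _ _ (tinv_linear tx).
pose T' : {linear 'rV[R]_r -> E x} := HB.pack (tinv t x) T.
pose K := GRing.isLinear.Build _ _ _ _ _ (Llin x tx).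
pose K' : {scalar E x} := HB.pack (L x) K.
rewrite -[X in L x X](tmapK tx) [X in tinv t x X]row_sum_delta.
rewrite -[tinv t x]/(T' : _ -> _) -[L x]/(K' : _ -> _) !linear_sum.
apply: eq_bigr => j _; rewrite /F -[L x _]/(K' (T' _)) -linearZ -linearZ.
by [].
Qed.

Section sections.
Context {r : nat} (E : vbundle r).

Definition smooth_section (s : forall x, E x) : Prop :=
  forall t, trivs t -> forall j, smooth_in (tdom t) (fun x => tmap t (s x) 0 j).

Record Gamma := MkGamma {
  section_fun :> forall x, E x; GammaP : smooth_section section_fun }.

Lemma Gamma_eq (s t : Gamma) : (forall x, s x = t x) -> s = t.
Proof.
case: s t => [s sP] [t tP] /= st.
have E' : s = t by apply: functional_extensionality_dep.
by case: _ / E' tP {st} => tP; congr MkGamma; exact: Prop_irrelevance.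
Qed.

HB.instance Definition _ := gen_eqMixin Gamma.
HB.instance Definition _ := gen_choiceMixin Gamma.

Fact smooth_section0 : smooth_section (fun=> 0).
Proof.
move=> t _ j; apply: (smooth_in_eq (tdom_open t) _ (smooth_in_cst _ 0)) => x tx.
have := tmap_linear tx (-1) 0 0; rewrite !scaleN1r !addNr => ->.
by rewrite mxE.
Qed.

Fact smooth_sectionZD (f : Cinf M) (s t : Gamma) :
  smooth_section (fun x => f x *: s x + t x).
Proof.
move=> a aP j; have oa := tdom_open a.
have fP : smooth_in (tdom a) f by apply: smooth_in_sub (CinfP f).
apply: (smooth_in_eq oa _ (smooth_inD oa (smooth_inM oa fP (GammaP s aP j))
                             (GammaP t aP j))) => x ax.
by rewrite tmap_linear // !mxE.
Qed.

Fact smooth_sectionZ (f : Cinf M) (s : Gamma) :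
  smooth_section (fun x => f x *: s x).
Proof.
have := smooth_sectionZD f s (MkGamma smooth_section0).
by congr smooth_section; apply: functional_extensionality_dep => x; rewrite addr0.
Qed.

Fact smooth_sectionD (s t : Gamma) : smooth_section (fun x => s x + t x).
Proof.
have := smooth_sectionZD 1 s t.
by congr smooth_section; apply: functional_extensionality_dep => x; rewrite scale1r.
Qed.

Fact smooth_sectionN (s : Gamma) : smooth_section (fun x => - s x).
Proof.
have := smooth_sectionZ (Ccst M (-1)) s.
by congr smooth_section; apply: functional_extensionality_dep => x; rewrite scaleN1r.
Qed.

Definition Gzero := MkGamma smooth_section0.
Definition Gadd s t := MkGamma (smooth_sectionD s t).
Definition Gopp s := MkGamma (smooth_sectionN s).
Definition Gscale f s := MkGamma (smooth_sectionZ f s).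

Fact GaddA : associative Gadd.
Proof. by move=> f g h; apply: Gamma_eq => x /=; rewrite addrA. Qed.
Fact GaddC : commutative Gadd.
Proof. by move=> f g; apply: Gamma_eq => x /=; rewrite addrC. Qed.
Fact Gadd0 : left_id Gzero Gadd.
Proof. by move=> f; apply: Gamma_eq => x /=; rewrite add0r. Qed.
Fact GaddN : left_inverse Gzero Gopp Gadd.
Proof. by move=> f; apply: Gamma_eq => x /=; rewrite addNr. Qed.
HB.instance Definition _ := GRing.isZmodule.Build Gamma GaddA GaddC Gadd0 GaddN.

Fact GscaleA f g s : Gscale f (Gscale g s) = Gscale (f * g) s.
Proof. by apply: Gamma_eq => x /=; rewrite scalerA. Qed.
Fact Gscale1 : left_id 1 Gscale.
Proof. by move=> s; apply: Gamma_eq => x /=; rewrite scale1r. Qed.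
Fact GscaleDr : right_distributive Gscale +%R.
Proof. by move=> f s t; apply: Gamma_eq => x /=; rewrite scalerDr. Qed.
Fact GscaleDl s : {morph Gscale^~ s : f g / f + g}.
Proof. by move=> f g; apply: Gamma_eq => x /=; rewrite scalerDl. Qed.
HB.instance Definition _ := GRing.Zmodule_isLmodule.Build (Cinf M) Gamma
  GscaleA Gscale1 GscaleDr GscaleDl.

End sections.

Record bundle_map r r' (E : vbundle r) (F : vbundle r') := BundleMap {
  bmap_fun :> forall x, E x -> F x;
  bmap_linear : forall x, linear (@bmap_fun x);
  bmap_smooth : forall s t, trivs s -> trivs t -> forall v j,
    smooth_in (tdom s `&` tdom t)
      (fun x => tmap t (@bmap_fun x (tinv s x v)) 0 j) }.

(* Bundle maps rho : E -> TM over the identity. Smoothness: rho sends the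
   elements of local frames to smooth local vector fields, a vector field being
   smooth when it maps smooth functions to smooth functions. *)
Record anchor r (E : vbundle r) := Anchor {
  anchor_fun :> forall x, E x -> tangent x;
  anchor_linear : forall x f, scalar (fun u => @anchor_fun x u f);
  anchor_smooth : forall t, trivs t -> forall v f,
    smooth_in (tdom t) (fun x => @anchor_fun x (tinv t x v) f) }.

(* Smooth families of bilinear forms on the fibers, i.e. C^oo(M)-bilinear
   forms on sections. *)
Record bilinear_form r (E : vbundle r) := BilinearForm {
  bform_fun :> forall x, E x -> E x -> R;
  bform_linearl : forall x v, scalar (fun u => @bform_fun x u v);
  bform_linearr : forall x u, scalar (@bform_fun x u);
  bform_smooth : forall t, trivs t -> forall v w,
    smooth_in (tdom t) (fun x => @bform_fun x (tinv t x v) (tinv t x w)) }.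

End vbundle.
Arguments vbundle {R n} M r.

Section actions.
Context {R : realType} {n : nat} {M : manifold R n} {r : nat} {E : vbundle M r}.
Implicit Types (B : bilinear_form E) (P : bundle_map E E) (rho : anchor E).

Lemma smooth_cover (f : M -> R) :
  (forall t : local_triv r E, trivs t -> smooth_in (tdom t) f) ->
  smooth_in setT f.
Proof.
move=> H; apply: smooth_in_local => x _; have [t tt tx] := trivs_cover E x.
by exists (tdom t) => //; exact: H.
Qed.

Fact anchor_act_smooth rho (e : Gamma E) (f : Cinf M) :
  smooth_in setT (fun x => rho x (e x) f).
Proof.
apply: smooth_cover => t tt.
apply: (smooth_contract (L := fun x u => rho x u f) (GammaP e tt)) => [x _|v].
  exact: anchor_linear.
exact: anchor_smooth.
Qed.

Definition anchor_act rho (e : Gamma E) (f : Cinf M) : Cinf M :=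
  MkCinf (anchor_act_smooth rho e f).

Fact pairing_smooth B (e1 e2 : Gamma E) :
  smooth_in setT (fun x => B x (e1 x) (e2 x)).
Proof.
apply: smooth_cover => t tt.
apply: (smooth_contract (L := fun x u => B x u (e2 x)) (GammaP e1 tt)) => [x _|v].
  exact: bform_linearl.
apply: (smooth_contract (L := fun x => B x (tinv t x v)) (GammaP e2 tt)) => [x _|w].
  exact: bform_linearr.
exact: bform_smooth.
Qed.

Definition pairing B (e1 e2 : Gamma E) : Cinf M :=
  MkCinf (pairing_smooth B e1 e2).

Lemma bmap_local_smooth P (t : local_triv r E) (s : forall x, E x) : trivs t ->
  (forall j, smooth_in (tdom t) (fun x => tmap t (s x) 0 j)) ->
  forall j, smooth_in (tdom t) (fun x => tmap t (P x (s x)) 0 j).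
Proof.
move=> tt sP j.
apply: (smooth_contract (L := fun x u => tmap t (P x u) 0 j) sP) => [x tx|v].
  by move=> a u v; rewrite bmap_linear tmap_linear // !mxE.
by have := bmap_smooth P tt tt v j; rewrite setIid.
Qed.

Fact bmap_act_smooth P (e : Gamma E) : smooth_section (fun x => P x (e x)).
Proof. by move=> t tt; apply: bmap_local_smooth => //; exact: GammaP. Qed.

Definition bmap_act P (e : Gamma E) : Gamma E := MkGamma (bmap_act_smooth P e).

Fact twist_linearl B P x v : scalar (fun u => B x u (P x v)).
Proof. exact: bform_linearl. Qed.

Fact twist_linearr B P x u : scalar (fun v => B x u (P x v)).
Proof. by move=> a v w; rewrite bmap_linear bform_linearr. Qed.

Fact twist_smooth B P (t : local_triv r E) : trivs t -> forall v w,
  smooth_in (tdom t) (fun x => B x (tinv t x v) (P x (tinv t x w))).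
Proof.
move=> tt v w.
apply: (smooth_contract (t := t) (s := fun x => P x (tinv t x w))
          (L := fun x => B x (tinv t x v))) => [j|x _|v'].
- by have := bmap_smooth P tt tt w j; rewrite setIid.
- exact: bform_linearr.
- exact: bform_smooth.
Qed.

Definition twist_form B P : bilinear_form E :=
  BilinearForm (twist_linearl B P) (twist_linearr B P) (twist_smooth B P).

End actions.

Section algebroids.
Context {R : realType} {n : nat} {M : manifold R n} {r : nat} {E : vbundle M r}.
Implicit Types (B : bilinear_form E) (P : bundle_map E E) (rho : anchor E).
Implicit Types (br star nabla : Gamma E -> Gamma E -> Gamma E).

Definition symmetric_form B := forall x (u v : E x), B x u v = B x v u.

Definition skew_form B := forall x (u v : E x), B x u v = - B x v u.

Definition nondegenerate_form B :=
  forall x (u : E x), (forall v, B x u v = 0) -> u = 0.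

(* Real scalars act on sections as constant functions. *)
Definition R_bilinear (op : Gamma E -> Gamma E -> Gamma E) : Prop :=
  (forall c e1 e2 e3,
     op (Ccst M c *: e1 + e2) e3 = Ccst M c *: op e1 e3 + op e2 e3) /\
  (forall c e1 e2 e3,
     op e1 (Ccst M c *: e2 + e3) = Ccst M c *: op e1 e2 + op e1 e3).

Record lie_algebroid br rho : Prop := LieAlgebroid {
  lie_bilinear : R_bilinear br;
  lie_alternating : forall e, br e e = 0;
  lie_jacobi : forall e1 e2 e3,
    br e1 (br e2 e3) + br e2 (br e3 e1) + br e3 (br e1 e2) = 0;
  lie_leibniz : forall e1 e2 (f : Cinf M),
    br e1 (f *: e2) = f *: br e1 e2 + anchor_act rho e1 f *: e2 }.

Record pseudo_riemannian_lie_algebroid br rho g : Prop := PRLieAlgebroid {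
  pr_lie : lie_algebroid br rho;
  pr_symmetric : symmetric_form g;
  pr_nondegenerate : nondegenerate_form g }.

Record E_connection rho nabla : Prop := EConnection {
  conn_bilinear : R_bilinear nabla;
  conn_linear : forall (f : Cinf M) e1 e2,
    nabla (f *: e1) e2 = f *: nabla e1 e2;
  conn_leibniz : forall (f : Cinf M) e1 e2,
    nabla e1 (f *: e2) = f *: nabla e1 e2 + anchor_act rho e1 f *: e2 }.

Record levi_civita br rho g nabla : Prop := LeviCivita {
  lc_connection : E_connection rho nabla;
  lc_metric : forall e1 e2 e3, anchor_act rho e1 (pairing g e2 e3) =
    pairing g (nabla e1 e2) e3 + pairing g e2 (nabla e1 e3);
  lc_torsion : forall e1 e2, br e1 e2 = nabla e1 e2 - nabla e2 e1 }.

(* The section D f determined by (D f, e) = rho(e)(f) for all e; it exists and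
   is unique when B is nondegenerate. *)
Definition grad rho B (f : Cinf M) : Gamma E :=
  xget 0 [set d : Gamma E | forall e, pairing B d e = anchor_act rho e f].

Definition associator star (e1 e2 e3 : Gamma E) : Gamma E :=
  star e1 (star e2 e3) - star (star e1 e2) e3.

Definition commutator star (e1 e2 : Gamma E) : Gamma E :=
  star e1 e2 - star e2 e1.

Definition presymT star B (e1 e2 e3 : Gamma E) : Cinf M :=
  pairing B (star e1 e2) e3 + pairing B e1 (star e2 e3)
  - pairing B (star e2 e1) e3 - pairing B e2 (star e1 e3).

Record presymplectic_algebroid star rho B : Prop := PreSymplecticAlgebroid {
  ps_nondegenerate : nondegenerate_form B;
  ps_skew : skew_form B;
  ps_bilinear : R_bilinear star;
  ps_associator : forall e1 e2 e3,
    associator star e1 e2 e3 - associator star e2 e1 e3 =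
    Ccst M 6^-1 *: grad rho B (presymT star B e1 e2 e3);
  ps_invariance : forall e1 e2 e3, anchor_act rho e1 (pairing B e2 e3) =
    pairing B (star e1 e2 - Ccst M 2^-1 *: grad rho B (pairing B e1 e2)) e3
    + pairing B e2 (commutator star e1 e3) }.

Record para_complex_presymplectic_algebroid star rho B P : Prop :=
  ParaComplexPreSymplecticAlgebroid {
  pc_presymplectic : presymplectic_algebroid star rho B;
  pc_involution : forall x (u : E x), P x (P x u) = u;
  pc_skew : forall x (u v : E x), B x (P x u) (P x v) = - B x u v;
  pc_integrable : forall e1 e2, bmap_act P (star e1 e2) =
    star (bmap_act P e1) e2 + star e1 (bmap_act P e2)
    - bmap_act P (star (bmap_act P e1) (bmap_act P e2)) }.

Definition eigenbundle P (c : R) (x : M) : set (E x) :=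
  [set u | P x u = c *: u].

Definition eigensections P (c : R) : set (Gamma E) :=
  [set e | forall x, eigenbundle P c (e x)].

End algebroids.

(* Main.v *)
From HB Require Import structures.
Require Import Defs.
From mathcomp Require Import all_boot all_order all_algebra.
From mathcomp Require Import all_classical all_reals.
From mathcomp Require Import topology normedtype derive sequences exp realfun.
From mathcomp Require Import ring lra.
Set Implicit Arguments.
Unset Strict Implicit.
Unset Printing Implicit Defensive.
Import Order.TTheory GRing.Theory Num.Theory numFieldNormedType.Exports.
Local Open Scope classical_set_scope.
Local Open Scope ring_scope.

(** Write w for the skew form omega, D f for the section dual to df, and
    g (u, v) = w (u, P v).  Since P is w-skew, g is symmetric, and it is
    nondegenerate because P is invertible.

    The Lie algebroid.  Feeding f e3 into the last slot of the invariance
    axiom gives the Leibniz rule of the bracket at once, and feeding f e2 into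
    the middle slot gives
      e1 * (f e2) = f (e1 * e2) + rho(e1)(f) e2 + 1/2 w(e1, e2) D f,
      (f e1) * e2 = f (e1 * e2) - 1/2 w(e1, e2) D f.
    The Jacobiator is the cyclic sum of (e1,e2,e3) - (e2,e1,e3), that is 1/6 of
    the gradient of the cyclic sum of T, and that sum vanishes identically
    ([presymT_cyclic], [commutator_lie_algebroid]).

    The Levi-Civita connection.  Rewriting each term of the Koszul formula
    with the invariance axiom turns it into w (section, e3); the gradients
    cancel and what remains is the closed formula
      nabla e1 e2 = 1/2 (P (e1 * P e2) + P (e2 * P e1) + [e1, e2]).
    Torsion-freeness is then visible, compatibility with g is a linear
    combination of four instances of invariance ([connection_metric]), and the
    connection axioms follow from the two rules for * above: the gradient
    terms cancel since w is skew and g is symmetric.  On the eigenbundles the integrability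
    of P reads 2 P (x * y) = 2 x * y, respectively -2 x * y, so P acts on x * y
    by the sign of the eigenbundle and the closed formula collapses to x * y.

    Two facts of differential geometry carry these computations from sections
    to vector bundles.  Every vector of a fibre is the value of a global section
    ([section_through], by bump functions built from exp (-1/t)), so a section
    is determined by its pairings with sections, and identities between
    sections reduce to identities between real numbers ([pairing_inj]).  And a
    nondegenerate form represents smooth covector fields ([form_represents], by
    inverting its matrix in local frames), so D f exists. *)

(** * A smooth function that is flat at the origin *)

Section flat_function.
Context {R : realType}.

(** The factor t^-m makes the family stable under derivation: each derivative
    of exp (-1/t) is a combination of members. *)
Definition flat (m : nat) (t : R) : R :=
  if 0 < t then t^-1 ^+ m * expR (- t^-1) else 0.

Lemma flat_pos m t : 0 < t -> flat m t = t^-1 ^+ m * expR (- t^-1).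
Proof. by rewrite /flat => ->. Qed.

Lemma flat_npos m t : t <= 0 -> flat m t = 0.
Proof. by rewrite /flat leNgt => /negbTE ->. Qed.

(** A quadratic bound is what makes the difference quotient at 0 vanish; it
    comes from bounding exp (1/t) below by its Taylor term of order m + 2. *)
Lemma flat_bound m t : `|flat m t| <= (m.+2)`!%:R * t ^+ 2.
Proof.
case: (ltrP 0 t) => [t0|/flat_npos ->]; last first.
  by rewrite normr0 mulr_ge0 ?sqr_ge0 ?ler0n.
have e0 : 0 < expR t^-1 by exact: expR_gt0.
have u0 : 0 < t^-1 by rewrite invr_gt0.
rewrite flat_pos // expRN ger0_norm; last by rewrite mulr_ge0 ?exprn_ge0 ?invr_ge0 ?ltW.
rewrite ler_pdivrMr //.
have := @expR_ge1Dxn R t^-1 m.+1 (ltW u0).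
have f0 : 0 < (m.+2)`!%:R :> R by rewrite ltr0n fact_gt0.
move=> H; have {}H : t^-1 ^+ m.+2 <= (m.+2)`!%:R * expR t^-1.
  by rewrite mulrC -ler_pdivrMr //; apply: le_trans H; rewrite lerDr.
rewrite mulrAC -ler_pdivrMr ?exprn_gt0 // -exprVn -exprD addn2.
exact: H.
Qed.

Lemma is_derive_flat m (t : R) :
  is_derive t 1 (flat m) (flat m.+2 t - m%:R * flat m.+1 t).
Proof.
have [t0|t0|->] := ltrgtP t 0.
- rewrite !flat_npos ?ltW // mulr0 subr0.
  have E : \near t, (cst 0 : R -> R) t = flat m t.
    by apply: filterS (lt_nbhsl t0) => s s0; rewrite flat_npos // ltW.
  have [D1 D2] : is_derive t 1 (cst 0 : R -> R) 0 by exact: is_derive_cst.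
  apply: DeriveDef; first exact: near_eq_derivable E D1.
  by rewrite -(near_eq_derive _ E).
- have tn0 : t != 0 by rewrite gt_eqF.
  have E : \near t, t^-1 ^+ m * expR (- t^-1) = flat m t.
    by apply: filterS (lt_nbhsr t0) => s s0; rewrite flat_pos.
  have D : is_derive t 1 (fun t : R => t^-1 ^+ m * expR (- t^-1))
      (flat m.+2 t - m%:R * flat m.+1 t).
    have i1 : is_derive t 1 (fun s : R => s^-1) (- (t^-1) ^+ 2).
      apply: is_derive_eq; first exact: is_deriveV.
      by rewrite /GRing.scale /= mulr1 exprVn.
    have i2 := is_deriveN i1; have i3 := is_derive1_comp (is_derive_expR _) i2.
    have i4 := is_deriveX m i1.
    have i5 := is_deriveM i4 i3.
    rewrite (_ : (fun t : R => _) =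
      (fun s : R => s^-1) ^+ m * (expR \o - (fun s : R => s^-1))); last first.
      by apply/funext => s; rewrite !fctE.
    apply: (is_derive_eq i5); rewrite !flat_pos //= /GRing.scale /=.
    rewrite !fctE.
    case: m {E i4 i5} => [|m] /=; first by rewrite !expr0; ring.
    by rewrite !exprS; ring.
  case: D => D1 D2.
  apply: DeriveDef; first exact: near_eq_derivable E D1.
  by rewrite -(near_eq_derive _ E).
- rewrite !flat_npos // mulr0 subr0.
  have C : h^-1 *: ((flat m \o shift 0) (h *: 1) - flat m 0) @[h --> (0 : R)^']
      --> (0 : R).
    have L : (m.+2)`!%:R * `|h| @[h --> (0 : R)^'] --> (0 : R).
      apply: cvg_trans (_ : (m.+2)`!%:R * `|h| @[h --> (0 : R)] --> (0 : R)).
        by apply: cvg_app; exact: nbhs_dnbhs.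
      rewrite -[X in _ --> X](mulr0 ((m.+2)`!%:R)); apply: cvgMr.
      have c0 : h @[h --> (0 : R)] --> (0 : R) by exact: cvg_id.
      by have := cvg_norm c0; rewrite normr0; apply; exact: nbhs_filter.
    apply: norm_cvg0; apply: (squeeze_cvgr _ (cvg_cst 0) L).
    near=> h; have h0 : h != 0 by near: h; exact: nbhs_dnbhs_neq.
    have -> : (flat m \o shift 0) (h *: 1) - flat m 0 = flat m h.
      by rewrite /= [h *: _]mulr1 addr0 (flat_npos m (lexx 0)) subr0.
    rewrite normr_ge0 /= normrM normfV ler_pdivrMl ?normr_gt0 //.
    rewrite mulrCA -normrM -expr2 (ger0_norm (sqr_ge0 h)); exact: flat_bound.
  by apply: DeriveDef; [exact: cvgP C | exact: cvg_lim C].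
Unshelve. all: by end_near. Qed.

End flat_function.

(** * Closure properties of smooth functions *)

Section Ck_operations.
Context {R : realType} {n : nat}.
Implicit Types (U : set 'rV[R]_n) (f g : 'rV[R]_n -> R).

Lemma derive_comp_real (h : R -> R) (h' : R) f p v :
  is_derive (f p) 1 h h' -> differentiable f p ->
  differentiable (h \o f) p /\ 'D_v (h \o f) p = h' * 'D_v f p.
Proof.
move=> [dh <-] df.
have dh' : differentiable h (f p) by apply/derivable1_diffP.
have dhf := differentiable_comp df dh'.
split=> //; rewrite (deriveE v dhf) (deriveE v df) (diff_comp df dh') /=.
by rewrite (diff1E dh') derive1E mulrC.
Qed.

(** The induction on k runs over all m at once, because differentiating raises
    m by one and by two. *)
Lemma Ck_flat k m U f : open U -> Ck k U f -> Ck k U (flat m \o f).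
Proof.
move=> oU; elim: k m f => [|k IH] m f.
  move=> H p Up; apply: continuous_comp; first exact: H.
  apply: differentiable_continuous; apply/derivable1_diffP.
  by have [] := is_derive_flat m (f p).
move=> Hf; have [f1 f2] := Hf.
have dcomp p v : U p ->
    differentiable (flat m \o f) p /\ 'D_v (flat m \o f) p =
    (flat m.+2 (f p) - m%:R * flat m.+1 (f p)) * 'D_v f p.
  by move=> Up; apply: derive_comp_real (f1 _ Up); exact: is_derive_flat.
split=> [p Up|v]; first by have [] := dcomp p 0 Up.
have H1 := IH m.+2 _ (CkW Hf); have H2 := IH m.+1 _ (CkW Hf).
have H3 := CkM oU (CkD oU H1 (CkM oU (Ck_cst k U (- m%:R)) H2)) (f2 v).
apply: Ck_eq oU _ H3 => p /set_mem Up /=.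
by have [_ ->] := dcomp p v Up; rewrite mulNr.
Qed.

Lemma CkV k U f : open U -> (forall p, U p -> f p != 0) ->
  Ck k U f -> Ck k U (fun p => (f p)^-1).
Proof.
move=> oU; elim: k f => [|k IH] f f0.
  by move=> H p Up; apply: continuousV; [exact: f0|exact: H].
move=> Hf; have [f1 f2] := Hf; split=> [p Up|v].
  by apply: differentiableV; [exact: f1|exact: f0].
have H1 := IH _ f0 (CkW Hf).
have H2 := CkM oU (CkM oU (Ck_cst k U (-1)) (CkM oU H1 H1)) (f2 v).
apply: Ck_eq oU _ H2 => p /set_mem Up /=.
rewrite deriveV; [|exact: f0|exact: diff_derivable (f1 _ Up)].
by rewrite /GRing.scale /= mulN1r expr2 invfM.
Qed.

End Ck_operations.

Section smooth_functions.
Context {R : realType} {n : nat} {M : manifold R n}.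
Implicit Types (U V : set M) (f g : M -> R).

Lemma smooth_in_flat U f : open U ->
  smooth_in U f -> smooth_in U (fun x => flat 0 (f x)).
Proof.
move=> oU F c ac k; move: (F c ac k).
by apply: (@Ck_flat R n k 0); exact: cimg_sub_open.
Qed.

Lemma smooth_inV U f : open U -> (forall x, U x -> f x != 0) ->
  smooth_in U f -> smooth_in U (fun x => (f x)^-1).
Proof.
move=> oU f0 F c ac k; move: (F c ac k); apply: CkV.
  exact: cimg_sub_open.
by move=> _ [x [cx Ux] <-] /=; rewrite cmapK //; exact: f0.
Qed.

Lemma smooth_in_prod (I : Type) (s : seq I) U (F : I -> M -> R) : open U ->
  (forall i, smooth_in U (F i)) -> smooth_in U (fun x => \prod_(i <- s) F i x).
Proof.
move=> oU H; elim: s => [|i s IH].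
  apply: (smooth_in_eq oU _ (smooth_in_cst _ 1)) => x _ /=.
  by rewrite big_nil.
apply: (smooth_in_eq oU _ (smooth_inM oU (H i) IH)) => x _ /=.
by rewrite big_cons.
Qed.

Lemma smooth_in_det U m (A : M -> 'M[R]_m) : open U ->
  (forall i j, smooth_in U (fun x => A x i j)) ->
  smooth_in U (fun x => \det (A x)).
Proof.
move=> oU H; apply: smooth_in_sum => // s.
apply: smooth_inM => //; first exact: smooth_in_cst.
by apply: smooth_in_prod => // i.
Qed.

(** Cramer's rule. *)
Lemma smooth_in_invmx U m (A : M -> 'M[R]_m) : open U ->
  (forall i j, smooth_in U (fun x => A x i j)) ->
  (forall x, U x -> A x \in unitmx) ->
  forall i j, smooth_in U (fun x => invmx (A x) i j).
Proof.
move=> oU H uA i j.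
have dP : smooth_in U (fun x => (\det (A x))^-1).
  apply: smooth_inV => // [x /uA|]; last exact: smooth_in_det.
  by rewrite unitmxE unitfE.
have cP : smooth_in U (fun x => cofactor (A x) j i).
  apply: smooth_inM => //; first exact: smooth_in_cst.
  apply: smooth_in_det => // k l.
  by apply: (smooth_in_eq oU _ (H (lift j k) (lift i l))) => x _; rewrite !mxE.
apply: (smooth_in_eq oU _ (smooth_inM oU dP cP)) => x /uA ux.
by rewrite /invmx ux !mxE.
Qed.

Lemma smooth_in_cmap (c : chart R n M) j : atlas c ->
  smooth_in (cdom c) (fun x => cmap c x 0 j).
Proof. by move=> ac d ad; exact: atlas_compat ad ac j. Qed.

Lemma smooth_in_setU U V f :
  smooth_in U f -> smooth_in V f -> smooth_in (U `|` V) f.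
Proof.
move=> fU fV; apply: smooth_in_local => x [Ux|Vx]; first by exists U.
by exists V.
Qed.

(** The support is recorded through a closed set K inside U: a function that is
    smooth on U and zero off K glues to a global one.  Here K is a compact cube
    pulled back through a chart; the Hausdorff axiom makes it closed in M. *)
Lemma bump_function (x : M) U : open U -> U x ->
  exists f : Cinf M, f x != 0 /\
    exists2 K : set M, closed K & K `<=` U /\ forall y, ~ K y -> f y = 0.
Proof.
move=> oU Ux; have [c ac cx] := atlas_cover x.
have oI := cimg_sub_open (c := c) oU; set I := cmap c @` _ in oI.
have Ix : I (cmap c x) by exists x.
have /nbhs_ballP[e /= e0 eI] : nbhs (cmap c x) I by exact: open_nbhs_nbhs.
pose d := e / 2; have d0 : 0 < d by rewrite divr_gt0.
pose B := [set p : 'rV[R]_n |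
  forall j, `[cmap c x 0 j - d, cmap c x 0 j + d]%classic (p 0 j)].
have cB : compact B.
  apply: (@rV_compact R n (fun j =>
    `[cmap c x 0 j - d, cmap c x 0 j + d]%classic)) => j.
  exact: segment_compact.
have BI : B `<=` I.
  move=> p Bp; apply: eI; split=> // i j; rewrite (ord1 i).
  have := Bp j; rewrite /= in_itv /= => /andP[p1 p2].
  rewrite /ball /= ltr_norml; rewrite /d in d0 p1 p2; lra.
pose K := cinv c @` B.
have BK p : B p -> cmap c (cinv c p) = p /\ (cdom c `&` U) (cinv c p).
  by move=> /BI[y [cy Uy] <-]; rewrite cmapK.
have KU : K `<=` cdom c `&` U by move=> _ [p /BK[_ ?] <-].
have KB y : cdom c y -> B (cmap c y) -> K y.
  by move=> cy By; exists (cmap c y) => //; rewrite cmapK.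
have clK : closed K.
  apply: compact_closed; first exact: manifold_hausdorff.
  apply: continuous_compact cB.
  apply: continuous_subspaceW (@cinv_continuous _ _ _ c).
  by move=> p /BI[y [cy _] <-]; exists y.
(* flat 0 (q y) is a bump on a Euclidean ball, which lies in the cube; off the
   chart domain cmap is meaningless, hence the cut-off by K in f. *)
pose q y := d ^+ 2 - \sum_j (cmap c y 0 j - cmap c x 0 j) ^+ 2.
have qB y : 0 < q y -> B (cmap c y).
  rewrite subr_gt0 => qy j; rewrite /= in_itv /=.
  have : (cmap c y 0 j - cmap c x 0 j) ^+ 2 < d ^+ 2.
    apply: le_lt_trans qy; rewrite (bigD1 j) //= lerDl.
    by apply: sumr_ge0 => i _; exact: sqr_ge0.
  by move=> h; apply/andP; split; rewrite leNgt; apply/negP => h'; nra.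
pose f y := if pselect (K y) is left _ then flat 0 (q y) else 0.
have oc := cdom_open c.
have fP : smooth_in setT f.
  have -> : setT = cdom c `|` ~` K.
    apply/seteqP; split=> // y _.
    by have [/KU[cy _]|nK] := pselect (K y); [left|right].
  apply: smooth_in_setU.
    have qP : smooth_in (cdom c) q.
      apply: smooth_inD => //; first exact: smooth_in_cst.
      apply: smooth_inN => //; apply: smooth_in_sum => // j.
      suff: smooth_in (cdom c) (fun y => cmap c y 0 j - cmap c x 0 j).
        by move=> tP; exact: (smooth_inM oc tP tP).
      by apply: smooth_inD => //; [exact: smooth_in_cmap|exact: smooth_in_cst].
    apply: (smooth_in_eq oc _ (smooth_in_flat oc qP)) => y cy.
    rewrite /f; case: pselect => // nK; rewrite flat_npos // leNgt.
    by apply/negP => /qB/(KB _ cy).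
  have oK : open (~` K) by rewrite openC.
  apply: (smooth_in_eq oK _ (smooth_in_cst _ 0)) => y nK.
  by rewrite /f; case: pselect.
exists (MkCinf fP); split=> /=; last first.
  exists K => //; split=> [y /KU[]//|y nK]; by rewrite /f; case: pselect.
have qx : q x = d ^+ 2.
  by rewrite /q big1 ?subr0 // => j _; rewrite subrr expr0n.
have q0 : 0 < q x by rewrite qx exprn_gt0.
rewrite /f; case: pselect => [_|]; last by case; apply: KB (qB _ q0).
by rewrite flat_pos // expr0 mul1r gt_eqF // expR_gt0.
Qed.

End smooth_functions.

(** * Sections through a vector, and covectors represented by a form *)

Section linear_maps.
Context {R : realType} {V W : lmodType R} {L : V -> W} (linL : linear L).

Let K : {linear V -> W} :=
  HB.pack L (GRing.isLinear.Build _ _ _ _ _ linL).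

Lemma linear_map0 : L 0 = 0. Proof. exact: (linear0 K). Qed.
Lemma linear_mapN u : L (- u) = - L u. Proof. exact: (linearN K). Qed.
Lemma linear_mapD u v : L (u + v) = L u + L v. Proof. exact: (linearD K). Qed.
Lemma linear_mapZ a u : L (a *: u) = a *: L u. Proof. exact: (linearZ_LR K). Qed.
Lemma linear_map_sum (I : Type) (s : seq I) (F : I -> V) :
  L (\sum_(i <- s) F i) = \sum_(i <- s) L (F i).
Proof. exact: (linear_sum K). Qed.

End linear_maps.

Section bundle_forms.
Context {R : realType} {n : nat} {M : manifold R n} {r : nat} {E : vbundle M r}.
Implicit Types (B : bilinear_form E) (rho : anchor E).

(** Extend v with constant coordinates in a local trivialization and multiply by
    a bump function supported there. *)
Lemma section_through (x : M) (v : E x) : exists s : Gamma E, s x = v.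
Proof.
have [t tt tx] := trivs_cover E x; have oT := tdom_open t.
have [f [fx0 [K cK [KT fK]]]] := bump_function oT tx.
pose w := (f x)^-1 *: tmap t v.
pose s y : E y := if pselect (K y) is left _ then f y *: tinv t y w else 0.
have sE y : tdom t y -> s y = f y *: tinv t y w.
  by move=> ty; rewrite /s; case: pselect => // /fK ->; rewrite scale0r.
have sP : smooth_section s.
  move=> u uu j; have ou := tdom_open u.
  have -> : tdom u = (tdom u `&` tdom t) `|` (tdom u `&` ~` K).
    rewrite -setIUr; apply/seteqP; split=> [y uy|y []//]; split=> //.
    by have [/KT|] := pselect (K y); [left|right].
  have out : open (tdom u `&` tdom t) by exact: openI.
  apply: smooth_in_setU.
    have fP : smooth_in (tdom u `&` tdom t) f.
      by apply: smooth_in_sub (CinfP f).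
    have uP := trivs_compat tt uu w j; rewrite setIC in uP.
    apply: (smooth_in_eq out _ (smooth_inM out fP uP)) => y [uy ty].
    by rewrite sE // (linear_mapZ (tmap_linear uy)) mxE.
  have ouK : open (tdom u `&` ~` K) by apply: openI => //; rewrite openC.
  apply: (smooth_in_eq ouK _ (smooth_in_cst _ 0)) => y [uy nK].
  by rewrite /s; case: pselect => // _; rewrite (linear_map0 (tmap_linear uy)) mxE.
exists (MkGamma sP) => /=; rewrite sE //.
by rewrite /w (linear_mapZ (tinv_linear tx)) tmapK // scalerA mulfV // scale1r.
Qed.

Lemma bform0l B x v : B x 0 v = 0.
Proof. exact: (linear_map0 (W := R^o) (bform_linearl B v)). Qed.
Lemma bformNl B x u v : B x (- u) v = - B x u v.
Proof. exact: (linear_mapN (W := R^o) (bform_linearl B v)). Qed.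
Lemma bformDl B x u u' v : B x (u + u') v = B x u v + B x u' v.
Proof. exact: (linear_mapD (W := R^o) (bform_linearl B v)). Qed.
Lemma bformZl B x a u v : B x (a *: u) v = a * B x u v.
Proof. exact: (linear_mapZ (W := R^o) (bform_linearl B v)). Qed.
Lemma bformNr B x u v : B x u (- v) = - B x u v.
Proof. exact: (linear_mapN (W := R^o) (bform_linearr B u)). Qed.
Lemma bformDr B x u v v' : B x u (v + v') = B x u v + B x u v'.
Proof. exact: (linear_mapD (W := R^o) (bform_linearr B u)). Qed.
Lemma bformZr B x a u v : B x u (a *: v) = a * B x u v.
Proof. exact: (linear_mapZ (W := R^o) (bform_linearr B u)). Qed.

Lemma nondegenerate_inj B x (u u' : E x) : nondegenerate_form B ->
  (forall v, B x u v = B x u' v) -> u = u'.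
Proof.
move=> ndB H; apply/eqP; rewrite -subr_eq0; apply/eqP/ndB => v.
by rewrite bformDl bformNl H subrr.
Qed.

(** The main tool for identities between sections: it turns them into
    identities between real numbers. *)
Lemma pairing_inj B (s s' : Gamma E) : nondegenerate_form B ->
  (forall e x, pairing B s e x = pairing B s' e x) -> s = s'.
Proof.
move=> ndB H; apply: Gamma_eq => x; apply: nondegenerate_inj ndB _ => v.
by have [e <-] := section_through v; exact: H e x.
Qed.

(** In a local frame the representing vector is the row of values of alpha times
    the inverse of the matrix of B, hence smooth; by nondegeneracy the local
    solutions agree, so they define one global section. *)
Lemma form_represents B (alpha : forall x, E x -> R) : nondegenerate_form B ->
  (forall x, scalar (alpha x)) ->
  (forall t : local_triv r E, trivs t -> forall v,
     smooth_in (tdom t) (fun x => alpha x (tinv t x v))) ->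
  exists d : Gamma E, forall x v, B x (d x) v = alpha x v.
Proof.
move=> ndB la sa.
pose A (t : local_triv r E) x : 'M[R]_r :=
  \matrix_(i, j) B x (tinv t x (delta_mx 0 i)) (tinv t x (delta_mx 0 j)).
pose b (t : local_triv r E) x : 'rV[R]_r :=
  \row_j alpha x (tinv t x (delta_mx 0 j)).
have linr (t : local_triv r E) x (L : E x -> R) : tdom t x -> scalar L ->
    forall v, L v = \sum_j tmap t v 0 j * L (tinv t x (delta_mx 0 j)).
  move=> tx Ll v.
  rewrite -[in LHS](tmapK tx v) [X in tinv t x X]row_sum_delta.
  rewrite (linear_map_sum (tinv_linear tx)) (linear_map_sum (W := R^o) Ll).
  apply: eq_bigr => j _; rewrite (linear_mapZ (tinv_linear tx)).
  exact: (linear_mapZ (W := R^o) Ll).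
have AE (t : local_triv r E) x u j : tdom t x ->
    (u *m A t x) 0 j = B x (tinv t x u) (tinv t x (delta_mx 0 j)).
  move=> tx; rewrite (linr t x (fun u => B x u _) tx) ?mxE; last exact: bform_linearl.
  by apply: eq_bigr => i _; rewrite mxE tinvK.
have uA (t : local_triv r E) x : tdom t x -> A t x \in unitmx.
  move=> tx; rewrite -row_free_unit; apply: inj_row_free => u uA0.
  apply: (can_inj (tinvK tx)); rewrite (linear_map0 (tinv_linear tx)).
  apply: ndB => v; rewrite (linr t x _ tx (bform_linearr B _)) big1 // => j _.
  by rewrite -AE // uA0 mxE mulr0.
pose loc (t : local_triv r E) x := tinv t x (b t x *m invmx (A t x)).
have locE (t : local_triv r E) x v : tdom t x -> B x (loc t x) v = alpha x v.
  move=> tx; rewrite (linr t x _ tx (bform_linearr B _)) (linr t x _ tx (la x)).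
  by apply: eq_bigr => j _; rewrite -AE // mulmxKV ?uA // mxE.
have dE x : exists d : E x, forall v, B x d v = alpha x v.
  have [t tt tx] := trivs_cover E x.
  by exists (loc t x) => v; exact: locE.
pose d x := sval (cid (dE x)).
have dP x v : B x (d x) v = alpha x v by exact: (svalP (cid (dE x))).
have dloc (t : local_triv r E) x : tdom t x -> d x = loc t x.
  by move=> tx; apply: nondegenerate_inj ndB _ => v; rewrite locE.
suff dS : smooth_section d by exists (MkGamma dS).
move=> t tt j; have oT := tdom_open t.
have P : smooth_in (tdom t) (fun x => \sum_i b t x 0 i * invmx (A t x) i j).
  apply: smooth_in_sum => // i; apply: smooth_inM => //.
    by apply: (smooth_in_eq oT _ (sa t tt (delta_mx 0 i))) => x _; rewrite mxE.
  apply: smooth_in_invmx => // [k l|x]; last exact: uA.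
  have := bform_smooth B tt (delta_mx 0 k) (delta_mx 0 l).
  by apply: (smooth_in_eq oT) => x _; rewrite mxE.
by apply: (smooth_in_eq oT _ P) => x tx; rewrite (dloc t) // tinvK // mxE.
Qed.

(** The choice in the definition of the gradient is not vacuous. *)
Lemma pairing_grad rho B f e : nondegenerate_form B ->
  pairing B (grad rho B f) e = anchor_act rho e f.
Proof.
move=> ndB.
have [||d dE] := @form_represents B (fun x u => rho x u f) ndB.
- by move=> x; exact: anchor_linear.
- by move=> t tt v; exact: anchor_smooth.
rewrite /grad; case: xgetP => [s _ -> //|].
by move=> /(_ d) []; move=> e'; apply: Cinf_eq => x /=; exact: dE.
Qed.

End bundle_forms.

(** * Values of sections and functions at a point *)

Section section_values.
Context {R : realType} {n : nat} {M : manifold R n} {r : nat} {E : vbundle M r}.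
Implicit Types (s t : Gamma E) (f g : Cinf M) (x : M).

Lemma GammaDE s t x : (s + t) x = s x + t x. Proof. by []. Qed.
Lemma GammaNE s x : (- s) x = - s x. Proof. by []. Qed.
Lemma GammaZE f s x : (f *: s) x = f x *: s x. Proof. by []. Qed.
Lemma CinfDE f g x : (f + g) x = f x + g x. Proof. by []. Qed.
Lemma CinfNE f x : (- f) x = - f x. Proof. by []. Qed.
Lemma CinfME f g x : (f * g) x = f x * g x. Proof. by []. Qed.
Lemma Gamma0E x : (0 : Gamma E) x = 0. Proof. by []. Qed.
Lemma Cinf0E x : (0 : Cinf M) x = 0. Proof. by []. Qed.
Lemma CcstE c x : Ccst M c x = c. Proof. by []. Qed.
Lemma pairingE (B : bilinear_form E) s t x : pairing B s t x = B x (s x) (t x).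
Proof. by []. Qed.
Lemma anchor_actE (rho : anchor E) s f x : anchor_act rho s f x = rho x (s x) f.
Proof. by []. Qed.
Lemma bmap_actE (P : bundle_map E E) s x : bmap_act P s x = P x (s x).
Proof. by []. Qed.
Definition valE := (GammaDE, GammaNE, GammaZE, Gamma0E, CinfDE, CinfNE, CinfME,
  Cinf0E, CcstE, pairingE, anchor_actE, bmap_actE).

Definition formE (B : bilinear_form E) :=
  (bformDl B, bformNl B, bformZl B, bformDr B, bformNr B, bformZr B).

Lemma pairingZr (B : bilinear_form E) s f t :
  pairing B s (f *: t) = f * pairing B s t.
Proof. by apply: Cinf_eq => x; exact: bformZr. Qed.

Lemma pairingZl (B : bilinear_form E) s f t :
  pairing B (f *: s) t = f * pairing B s t.
Proof. by apply: Cinf_eq => x; exact: bformZl. Qed.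

Lemma anchorZ (rho : anchor E) x a u f : rho x (a *: u) f = a * rho x u f.
Proof. exact: (linear_mapZ (W := R^o) (anchor_linear rho (x := x) f)). Qed.

End section_values.

Section R_bilinear_theory.
Context {R : realType} {n : nat} {M : manifold R n} {r : nat} {E : vbundle M r}.
Context {op : Gamma E -> Gamma E -> Gamma E} (opP : R_bilinear op).

Lemma R_bilinearDl a b c : op (a + b) c = op a c + op b c.
Proof. by have := opP.1 1 a b c; rewrite !scale1r. Qed.

Lemma R_bilinearDr a b c : op a (b + c) = op a b + op a c.
Proof. by have := opP.2 1 a b c; rewrite !scale1r. Qed.

Lemma R_bilinearNl a b : op (- a) b = - op a b.
Proof.
apply/eqP; rewrite -addr_eq0 -R_bilinearDl addNr; apply/eqP/(addrI (op 0 b)).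
by rewrite addr0 -R_bilinearDl addr0.
Qed.

Lemma R_bilinearNr a b : op a (- b) = - op a b.
Proof.
apply/eqP; rewrite -addr_eq0 -R_bilinearDr addNr; apply/eqP/(addrI (op a 0)).
by rewrite addr0 -R_bilinearDr addr0.
Qed.

Lemma R_bilinear_commutator : R_bilinear (commutator op).
Proof.
by split=> c e1 e2 e3; rewrite /commutator opP.1 opP.2 opprD addrACA -scalerBr.
Qed.

End R_bilinear_theory.

(** * The Lie algebroid of a pre-symplectic algebroid *)

Section presymplectic.
Context {R : realType} {n : nat} {M : manifold R n} {r : nat} {E : vbundle M r}.
Context {star : Gamma E -> Gamma E -> Gamma E} {rho : anchor E}.
Context {omega : bilinear_form E}.
Context (psP : presymplectic_algebroid star rho omega).
Implicit Types (e : Gamma E) (f : Cinf M) (x : M).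

Let ndw := ps_nondegenerate psP.
Let skw := ps_skew psP.
Let biP := ps_bilinear psP.

Lemma grad_value f x e :
  omega x (grad rho omega f x) (e x) = rho x (e x) f.
Proof. by have := congr1 (@Cinf_fun _ _ _ ^~ x) (pairing_grad rho f e ndw). Qed.

Lemma invariance_value e1 e2 e3 x :
  rho x (e1 x) (pairing omega e2 e3) =
  omega x (star e1 e2 x) (e3 x) - 2^-1 * rho x (e3 x) (pairing omega e1 e2)
  + (omega x (e2 x) (star e1 e3 x) - omega x (e2 x) (star e3 e1 x)).
Proof.
have := congr1 (@Cinf_fun _ _ _ ^~ x) (ps_invariance psP e1 e2 e3).
by rewrite !valE !formE grad_value.
Qed.

(** Invariance is tensorial in its last argument except for the bracket and the
    derivative on the left, whose defects must therefore match. *)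
Lemma commutator_leibniz e1 e2 f :
  commutator star e1 (f *: e2) =
  f *: commutator star e1 e2 + anchor_act rho e1 f *: e2.
Proof.
apply: (pairing_inj ndw) => e x; rewrite !valE !formE.
have H1 := invariance_value e1 e (f *: e2) x.
have H2 := invariance_value e1 e e2 x.
rewrite pairingZr tangentM !valE !formE anchorZ in H1.
rewrite !(skw _ (e x)).
move: H1; rewrite H2; lra.
Qed.

Lemma star_leibnizr e1 e2 f : star e1 (f *: e2) =
  f *: star e1 e2 + anchor_act rho e1 f *: e2
  + (Ccst M 2^-1 * pairing omega e1 e2) *: grad rho omega f.
Proof.
apply: (pairing_inj ndw) => e x; rewrite !valE !formE grad_value.
have H1 := invariance_value e1 (f *: e2) e x.
have H2 := invariance_value e1 e2 e x.
rewrite pairingZr pairingZl !tangentM !valE !formE in H1.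
move: H1; rewrite H2; lra.
Qed.

(** Through the bracket, whose Leibniz rule has no gradient term: swapping the
    arguments of omega changes the sign of the gradient term. *)
Lemma star_leibnizl e1 e2 f : star (f *: e1) e2 =
  f *: star e1 e2
  - (Ccst M 2^-1 * pairing omega e1 e2) *: grad rho omega f.
Proof.
apply: (pairing_inj ndw) => e x.
have := congr1 (fun s : Gamma E => omega x (s x) (e x))
  (commutator_leibniz e2 e1 f).
rewrite /commutator star_leibnizr !valE !formE (skw (e2 x) (e1 x)); lra.
Qed.

(** Each value omega (ei * ej, ek) occurs in the sum twice, with opposite signs
    once the skew-symmetry of omega is used. *)
Lemma presymT_cyclic e1 e2 e3 :
  presymT star omega e1 e2 e3 + presymT star omega e2 e3 e1
  + presymT star omega e3 e1 e2 = 0.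
Proof.
apply: Cinf_eq => x; rewrite /presymT !valE.
rewrite (skw (e1 x)) (skw (e1 x)) (skw (e2 x)) (skw (e2 x)) (skw (e3 x)) (skw (e3 x)).
lra.
Qed.

(** The Jacobi identity is the cyclic sum of the associator axiom, whose right
    side is a gradient of zero by [presymT_cyclic]. *)
Lemma commutator_lie_algebroid : lie_algebroid (commutator star) rho.
Proof.
split=> [|e|e1 e2 e3|]; last exact: commutator_leibniz.
- exact: R_bilinear_commutator.
- by rewrite /commutator subrr.
apply: (pairing_inj ndw) => e x.
have A e1' e2' e3' :
    omega x ((associator star e1' e2' e3' - associator star e2' e1' e3') x) (e x)
    = 6^-1 * rho x (e x) (presymT star omega e1' e2' e3').
  by rewrite (ps_associator psP) valE formE grad_value.
have := A e1 e2 e3; have := A e2 e3 e1; have := A e3 e1 e2.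
have := congr1 (rho x (e x)) (presymT_cyclic e1 e2 e3).
rewrite !tangentD.
have -> : rho x (e x) 0 = 0.
  by apply: (addrI (rho x (e x) 0)); rewrite -tangentD !addr0.
rewrite /associator /commutator.
rewrite !(R_bilinearDl biP, R_bilinearDr biP, R_bilinearNl biP, R_bilinearNr biP).
rewrite !valE !formE bform0l.
lra.
Qed.

End presymplectic.

(** * Uniqueness of the Levi-Civita connection *)

Section levi_civita_uniqueness.
Context {R : realType} {n : nat} {M : manifold R n} {r : nat} {E : vbundle M r}.
Context {br : Gamma E -> Gamma E -> Gamma E} {rho : anchor E}.
Context {g : bilinear_form E}.

(** The difference of two such connections gives a trilinear form that is
    symmetric in its first two arguments (torsion) and skew in its last two
    (metric), and such a form is its own opposite. *)
Lemma levi_civita_unique nabla nabla' :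
  Defs.symmetric_form g -> nondegenerate_form g ->
  levi_civita br rho g nabla -> levi_civita br rho g nabla' -> nabla = nabla'.
Proof.
move=> syg ndg [_ met tor] [_ met' tor'].
apply/funext => e1; apply/funext => e2; apply: (pairing_inj ndg) => e3 x.
pose t a b (c : Gamma E) := g x (nabla a b x) (c x) - g x (nabla' a b x) (c x).
have tS a b c : t a b c = t b a c.
  have := congr1 (fun s : Gamma E => g x (s x) (c x)) (tor a b).
  have := congr1 (fun s : Gamma E => g x (s x) (c x)) (tor' a b).
  rewrite !valE !formE /t; lra.
have tA a b c : t a b c = - t a c b.
  have := congr1 (@Cinf_fun _ _ _ ^~ x) (met a b c).
  have := congr1 (@Cinf_fun _ _ _ ^~ x) (met' a b c).
  rewrite !valE !(syg _ (b x)) /t; lra.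
have : t e1 e2 e3 = - t e1 e2 e3.
  by rewrite {1}tA tS tA tS tA tS !opprK.
rewrite /t !valE; lra.
Qed.

End levi_civita_uniqueness.

(** * The connection of a para-complex pre-symplectic algebroid *)

Section para_complex.
Context {R : realType} {n : nat} {M : manifold R n} {r : nat} {E : vbundle M r}.
Context (star : Gamma E -> Gamma E -> Gamma E) {rho : anchor E}.
Context {omega : bilinear_form E} (P : bundle_map E E).
Context (pcP : para_complex_presymplectic_algebroid star rho omega P).
Implicit Types (e : Gamma E) (f : Cinf M) (x : M).

Let psP := pc_presymplectic pcP.
Let ndw := ps_nondegenerate psP.
Let skw := ps_skew psP.
Let biP := ps_bilinear psP.
Let PK := pc_involution pcP.
Let g := twist_form omega P.
Local Notation Pa := (bmap_act P).

Lemma form_para_complex x (u v : E x) : omega x (P x u) v = - omega x u (P x v).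
Proof. by rewrite -(pc_skew pcP) PK. Qed.

Lemma twist_formE x (u v : E x) : g x u v = omega x u (P x v).
Proof. by []. Qed.

Lemma twist_form_symmetric : Defs.symmetric_form g.
Proof. by move=> x u v; rewrite !twist_formE skw form_para_complex opprK. Qed.

Lemma twist_form_nondegenerate : nondegenerate_form g.
Proof.
by move=> x u H; apply: ndw => v; have := H (P x v); rewrite twist_formE PK.
Qed.

Lemma bmap_actD e1 e2 : Pa (e1 + e2) = Pa e1 + Pa e2.
Proof. by apply: Gamma_eq => x; exact: linear_mapD (bmap_linear P (x := x)) _ _. Qed.

Lemma bmap_actZ f e : Pa (f *: e) = f *: Pa e.
Proof. by apply: Gamma_eq => x; exact: linear_mapZ (bmap_linear P (x := x)) _ _. Qed.

(** What the Koszul formula gives once invariance has turned all its terms into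
    values of omega against e3. *)
Definition para_complex_connection e1 e2 : Gamma E :=
  Ccst M 2^-1 *: (Pa (star e1 (Pa e2)) + Pa (star e2 (Pa e1))
                  + commutator star e1 e2).
Local Notation nabla := para_complex_connection.

Lemma half_double e : Ccst M 2^-1 *: (e + e) = e.
Proof.
apply: Gamma_eq => x; rewrite !valE -[e x + e x]mulr2n -[e x *+ 2]scaler_nat scalerA.
by rewrite mulVf ?scale1r // pnatr_eq0.
Qed.

Lemma connection_torsion e1 e2 :
  commutator star e1 e2 = nabla e1 e2 - nabla e2 e1.
Proof.
rewrite -scalerBr [X in X + _ - _]addrC opprD addrACA subrr add0r.
by rewrite /commutator opprB half_double.
Qed.

Lemma connection_value e1 e2 e3 x : g x (nabla e1 e2 x) (e3 x) =
  2^-1 * (omega x (commutator star e1 e2 x) (P x (e3 x))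
          - omega x (star e1 (Pa e2) x) (e3 x)
          - omega x (star e2 (Pa e1) x) (e3 x)).
Proof.
rewrite twist_formE /nabla !valE !formE !form_para_complex PK; lra.
Qed.

(** The invariance axiom at P e2, expressed through g: the only form in which it
    enters the metric compatibility. *)
Lemma invariance_twist e1 e2 e3 x :
  rho x (e1 x) (pairing g e2 e3) =
  2^-1 * rho x (e3 x) (pairing g e1 e2) - omega x (star e1 (Pa e2) x) (e3 x)
  + (omega x (star e1 e3 x) (P x (e2 x)) - omega x (star e3 e1 x) (P x (e2 x))).
Proof.
have gP : pairing omega e1 (Pa e2) = pairing g e1 e2 by exact: Cinf_eq.
have gN : pairing omega (Pa e2) e3 = Ccst M (-1) * pairing g e2 e3.
  by apply: Cinf_eq => y; rewrite !valE form_para_complex mulN1r.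
have := invariance_value psP e1 (Pa e2) e3 x.
rewrite gP gN tangentZ !valE !(skw (P x (e2 x))); lra.
Qed.

(** The sum of the instances (1,2,3) and (1,3,2) of invariance gives twice the
    claim up to omega (e2 * P e1, e3) + omega (e3 * P e1, e2) and the derivatives
    of g along e2 and e3; the sum of the instances (2,1,3) and (3,1,2) says that
    these cancel. *)
Lemma connection_metric e1 e2 e3 : anchor_act rho e1 (pairing g e2 e3) =
  pairing g (nabla e1 e2) e3 + pairing g e2 (nabla e1 e3).
Proof.
have gC a b : pairing g a b = pairing g b a.
  by apply: Cinf_eq => y; exact: twist_form_symmetric.
apply: Cinf_eq => x.
rewrite (gC e2 (nabla _ _)) !valE -!/(pairing g _ _ x).
rewrite !connection_value !valE !formE.
have := invariance_twist e1 e2 e3 x; have := invariance_twist e1 e3 e2 x.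
have := invariance_twist e2 e1 e3 x; have := invariance_twist e3 e1 e2 x.
rewrite (gC e3 e2) (gC e3 e1) (gC e2 e1); lra.
Qed.

(** The gradient terms of the bracket cancel by skew-symmetry of omega, those of
    the two other summands by symmetry of g. *)
Lemma connection_linear f e1 e2 : nabla (f *: e1) e2 = f *: nabla e1 e2.
Proof.
apply: (pairing_inj twist_form_nondegenerate) => e3 x.
rewrite pairingZl !valE !connection_value /commutator bmap_actZ.
rewrite !(star_leibnizr psP) !(star_leibnizl psP) !valE !formE.
rewrite form_para_complex (skw (e2 x) (e1 x)) (skw (e2 x) (P x (e1 x))) form_para_complex.
ring.
Qed.

(** Linearity in the second argument follows from the first by the vanishing of
    the torsion. *)
Lemma connection_bilinear : R_bilinear nabla.
Proof.
suff L c e1 e2 e3 : nabla (Ccst M c *: e1 + e2) e3 =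
    Ccst M c *: nabla e1 e3 + nabla e2 e3.
  split=> [|c e1 e2 e3]; first exact: L.
  have N a b : nabla a b = nabla b a + commutator star a b.
    by rewrite connection_torsion addrC subrK.
  rewrite !(N e1) L (R_bilinear_commutator biP).2 (scalerDr _ (nabla e2 e1)).
  by rewrite addrACA.
apply: (pairing_inj twist_form_nondegenerate) => e x.
rewrite !valE [RHS](bformDl g) [X in _ = X + _](bformZl g) !connection_value.
rewrite /commutator bmap_actD bmap_actZ.
rewrite !biP.1 !biP.2 !valE !formE; ring.
Qed.

Lemma connection_leibniz f e1 e2 : nabla e1 (f *: e2) =
  f *: nabla e1 e2 + anchor_act rho e1 f *: e2.
Proof.
have N a b : nabla a b = nabla b a + commutator star a b.
  by rewrite connection_torsion addrC subrK.
rewrite !(N e1) connection_linear (commutator_leibniz psP) (scalerDr _ (nabla e2 e1)).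
by rewrite addrA.
Qed.

Lemma para_complex_levi_civita :
  levi_civita (commutator star) rho g nabla.
Proof.
split; [split| |].
- exact: connection_bilinear.
- exact: connection_linear.
- exact: connection_leibniz.
- exact: connection_metric.
- exact: connection_torsion.
Qed.

(** Integrability gives P (x * y) = x * y + x * y - P (x * y). *)
Lemma star_positive (x y : Gamma E) :
  Pa x = x -> Pa y = y -> Pa (star x y) = star x y.
Proof.
move=> Px Py; have := pc_integrable pcP x y; rewrite Px Py => H.
rewrite -[LHS]half_double {2}H addrC subrK; exact: half_double.
Qed.

Lemma star_negative (x y : Gamma E) : Pa x = - x -> Pa y = - y ->
  Pa (star x y) = - star x y.
Proof.
move=> Px Py; have := pc_integrable pcP x y; rewrite Px Py.
rewrite !(R_bilinearNl biP, R_bilinearNr biP) opprK => H.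
rewrite -[LHS]half_double {2}H addrC subrK; exact: half_double.
Qed.

Lemma connection_positive (x y : Gamma E) :
  Pa x = x -> Pa y = y -> nabla x y = star x y.
Proof.
move=> Px Py; rewrite /nabla Px Py !star_positive // /commutator.
by rewrite addrACA subrr addr0 half_double.
Qed.

Lemma connection_negative (x y : Gamma E) :
  Pa x = - x -> Pa y = - y -> nabla x y = star x y.
Proof.
have PN e : Pa (- e) = - Pa e.
  by apply: Gamma_eq => z; exact: linear_mapN (bmap_linear P (x := z)) _.
move=> Px Py; rewrite /nabla Px Py !(R_bilinearNr biP) !PN !star_negative // !opprK.
by rewrite /commutator addrACA subrr addr0 half_double.
Qed.

End para_complex.

Theorem proposition5p12 (R : realType) (n : nat) (M : manifold R n) (r : nat)
    (E : vbundle M r) (star : Gamma E -> Gamma E -> Gamma E) (rho : anchor E)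
    (omega : bilinear_form E) (P : bundle_map E E) :
  para_complex_presymplectic_algebroid star rho omega P ->
  pseudo_riemannian_lie_algebroid
    (commutator star) rho (twist_form omega P) /\
  exists nabla : Gamma E -> Gamma E -> Gamma E,
    unique (levi_civita (commutator star) rho (twist_form omega P)) nabla /\
    (forall x y : Gamma E, eigensections P 1 x -> eigensections P 1 y ->
       nabla x y = star x y) /\
    (forall xi eta : Gamma E, eigensections P (-1) xi ->
       eigensections P (-1) eta -> nabla xi eta = star xi eta).
Proof.
move=> pcP; have psP := pc_presymplectic pcP.
have syg := twist_form_symmetric pcP; have ndg := twist_form_nondegenerate pcP.
split; first by split => //; exact: commutator_lie_algebroid psP.
have lcP := para_complex_levi_civita pcP.
exists (para_complex_connection star P); split; first split=> // nabla' lcP'.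
  exact: levi_civita_unique syg ndg lcP lcP'.
have eigP s : eigensections P 1 s -> bmap_act P s = s.
  by move=> Hs; apply: Gamma_eq => x; rewrite -[RHS]scale1r; exact: Hs.
have eigN s : eigensections P (-1) s -> bmap_act P s = - s.
  by move=> Hs; apply: Gamma_eq => x; rewrite valE -scaleN1r; exact: Hs.
split=> [x y /eigP Px /eigP Py|x y /eigN Px /eigN Py].
  exact: (connection_positive pcP).
exact: (connection_negative pcP).
Qed.
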